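(* Let $\gamma_1,\gamma_2>0$. Assume that both $f(x,y)$ and $g(x,y)$ are convex in $y$ on $Y$ for any $x\in X$ and are continuously differentiable on an open set containing $X\times Y$. Then $\mathcal{G}_{\gamma}(x,y,z)$ is continuously differentiable on $X\times Y\times\mathbb{R}^p_+$, and for any $(x,y,z)\in X\times Y\times\mathbb{R}^p_+$, $$\nabla\mathcal{G}_{\gamma}(x,y,z)=\begin{pmatrix}\nabla_x f(x,y)+(\lambda^* )^{T}\nabla_x g(x,y)\\ \nabla_y f(x,y)+(\lambda^* )^{T}\nabla_y g(x,y)\\ -(z-\lambda^* )/\gamma_2\end{pmatrix}-\begin{pmatrix}\nabla_x f(x,\theta^* )+z^{T}\nabla_x g(x,\theta^* )\\ (y-\theta^* )/\gamma_1\\ g(x,\theta^* )\end{pmatrix},$$ where $\theta^*$ and $\lambda^*$ denote $\theta^*(x,y,z)$ and $\lambda^*(x,y,z)$, respectively, defined as $$\theta^*(x,y,z):=\operatorname*{argmin}_{\theta\in Y}\Big\{f(x,\theta)+z^{T}g(x,\theta)+\tfrac{1}{2\gamma_1}\|\theta-y\|^2\Big\},$$ $$\lambda^*(x,y,z):=\operatorname*{argmax}_{\lambda\in\mathbb{R}^p_+}\Big\{f(x,y)+\lambda^{T}g(x,y)-\tfrac{1}{2\gamma_2}\|\lambda-z\|^2\Big\}=\mathrm{Proj}_{\mathbb{R}^p_+}\big(z+\gamma_2 g(x,y)\big).$$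
   Context: $X\subseteq\mathbb{R}^n$ and $Y\subseteq\mathbb{R}^m$ are closed convex sets, $f$ is real-valued and $g$ is $\mathbb{R}^p$-valued (convexity of $g$ is meant componentwise). With $\mathcal{L}(x,y,z):=f(x,y)+z^{T}g(x,y)$ and $\gamma=(\gamma_1,\gamma_2)$, $$\mathcal{G}_{\gamma}(x,y,z):=\max_{\theta\in Y,\ \lambda\in\mathbb{R}^p_+}\Big\{\mathcal{L}(x,y,\lambda)-\tfrac{1}{2\gamma_2}\|\lambda-z\|^2-\mathcal{L}(x,\theta,z)-\tfrac{1}{2\gamma_1}\|\theta-y\|^2\Big\}.$$ Here $\lambda^{T}\nabla g=\sum_i\lambda_i\nabla g_i$, $\|\cdot\|$ is the Euclidean norm and $\mathrm{Proj}$ is the Euclidean projection. *)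

(* Defs.v *)
From HB Require Import structures.
From mathcomp Require Import all_boot all_order all_algebra.
From mathcomp Require Import all_classical all_reals all_analysis.
Import Order.TTheory GRing.Theory Num.Theory.
Import numFieldNormedType.Exports.

Set Implicit Arguments.
Unset Strict Implicit.
Unset Printing Implicit Defensive.

Local Open Scope classical_set_scope.
Local Open Scope ring_scope.

Section Optimization.
Context {R : realType}.

Definition is_argmin {T : Type} (A : set T) (F : T -> R) : set T :=
  [set t | A t /\ forall s, A s -> F t <= F s].

Definition is_argmax {T : Type} (A : set T) (F : T -> R) : set T :=
  [set t | A t /\ forall s, A s -> F s <= F t].

(* [argmin A F] and [argmax A F] are meaningful only when an optimizer exists,
   and [maxval A F] is a maximum only when it is attained. *)
Definition argmin {T : pointedType} (A : set T) (F : T -> R) : T :=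
  get (is_argmin A F).

Definition argmax {T : pointedType} (A : set T) (F : T -> R) : T :=
  get (is_argmax A F).

Definition maxval {T : Type} (A : set T) (F : T -> R) : R := sup (F @` A).

End Optimization.

Section Euclidean.
Context {R : realType}.

Definition dotv {k : nat} (u v : 'rV[R]_k) : R := \sum_i u 0 i * v 0 i.

(* The library norm [`|u|] of a row vector is the sup norm. *)
Definition enorm {k : nat} (u : 'rV[R]_k) : R := Num.sqrt (dotv u u).

Definition orthant (k : nat) : set 'rV[R]_k := [set u | forall i, 0 <= u 0 i].

Definition Proj {k : nat} (A : set 'rV[R]_k) (v : 'rV[R]_k) : 'rV[R]_k :=
  argmin A (fun u => enorm (u - v)).

Definition grad {k : nat} (h : 'rV[R]_k -> R) (u : 'rV[R]_k) : 'rV[R]_k :=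
  \row_i 'D_(delta_mx 0 i) h u.

End Euclidean.
Arguments orthant : clear implicits.

Section Smoothness.
Context {R : realType} {n m p : nat}.
Implicit Types f : 'rV[R]_n -> 'rV[R]_m -> R.

Definition gradx f (x : 'rV[R]_n) (y : 'rV[R]_m) : 'rV[R]_n :=
  grad (fun x' => f x' y) x.

Definition grady f (x : 'rV[R]_n) (y : 'rV[R]_m) : 'rV[R]_m :=
  grad (fun y' => f x y') y.

Definition C1_on (O : set ('rV[R]_n * 'rV[R]_m)) f : Prop :=
  forall w, O w ->
    [/\ differentiable (fun v => f v.1 v.2) w,
        {for w, continuous (fun v => gradx f v.1 v.2)} &
        {for w, continuous (fun v => grady f v.1 v.2)}].

Let E := ('rV[R]_n * 'rV[R]_m * 'rV[R]_p)%type.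

Definition dot3 (u v : E) : R :=
  dotv u.1.1 v.1.1 + dotv u.1.2 v.1.2 + dotv u.2 v.2.

(* First-order expansion of [F] at [w] along points of [S] only: [F] need not be
   meaningful off [S], and [S] need not be open.  At interior points of [S] this
   is Frechet differentiability with gradient [d]; in general only the component
   of [d] tangent to [S] is determined. *)
Definition is_gradient_within (S : set E) (F : E -> R) (w d : E) : Prop :=
  forall e : R, 0 < e -> \forall v \near within S (nbhs w),
    `|F v - F w - dot3 d (v - w)| <= e * `|v - w|.

Definition C1_within_with_gradient (S : set E) (F : E -> R) (dF : E -> E) :
    Prop :=
  (forall w, S w -> is_gradient_within S F w (dF w)) /\
  {within S, continuous dF}.

End Smoothness.

Section GapFunction.
Context {R : realType} {n m p : nat}.
Variables (Y : set 'rV[R]_m).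
Variables (f : 'rV[R]_n -> 'rV[R]_m -> R) (g : 'rV[R]_n -> 'rV[R]_m -> 'rV[R]_p).
Variables (gamma1 gamma2 : R).
Implicit Types (x : 'rV[R]_n) (y theta : 'rV[R]_m) (z lambda : 'rV[R]_p).

Definition gcomp (i : 'I_p) x y : R := g x y 0 i.

Definition Lagr x y z : R := f x y + dotv z (g x y).

Definition gap_obj x y z (tl : 'rV[R]_m * 'rV[R]_p) : R :=
  Lagr x y tl.2 - (2 * gamma2)^-1 * enorm (tl.2 - z) ^+ 2
  - Lagr x tl.1 z - (2 * gamma1)^-1 * enorm (tl.1 - y) ^+ 2.

Definition gap x y z : R := maxval (Y `*` orthant R p) (gap_obj x y z).

Definition theta_obj x y z theta : R :=
  f x theta + dotv z (g x theta) + (2 * gamma1)^-1 * enorm (theta - y) ^+ 2.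

Definition lambda_obj x y z lambda : R :=
  f x y + dotv lambda (g x y) - (2 * gamma2)^-1 * enorm (lambda - z) ^+ 2.

Definition theta_star x y z : 'rV[R]_m := argmin Y (theta_obj x y z).

Definition lambda_star x y z : 'rV[R]_p := argmax (orthant R p) (lambda_obj x y z).

Definition wgradx_g lambda x y : 'rV[R]_n :=
  \sum_i lambda 0 i *: gradx (gcomp i) x y.

Definition wgrady_g lambda x y : 'rV[R]_m :=
  \sum_i lambda 0 i *: grady (gcomp i) x y.

Definition gap_grad x y z : 'rV[R]_n * 'rV[R]_m * 'rV[R]_p :=
  let theta := theta_star x y z in
  let lambda := lambda_star x y z in
  (gradx f x y + wgradx_g lambda x y,
   grady f x y + wgrady_g lambda x y,
   - (gamma2^-1 *: (z - lambda)))
  - (gradx f x theta + wgradx_g z x theta,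
     gamma1^-1 *: (y - theta),
     g x theta).

End GapFunction.

(* Main.v *)
(** The objective of the maximum separates: the gap function is
    max_lambda lambda_obj - min_theta theta_obj.  Completing the square gives
    lambda* = Proj (z + gamma2 g(x,y)); coercivity gives theta*, and strong
    convexity makes it unique.  Adding the variational inequalities of two
    minimizers bounds |theta*(v) - theta*(w)| by the variation of the y-gradient
    of the Lagrangian at the single point theta*(w), whence theta* is continuous.
    Writing G for the objective and t for the pair of optimizers, the envelope
    formula follows from
      G(v, t(w)) - G(w, t(w)) <= gap(v) - gap(w) <= G(v, t(v)) - G(w, t(v)),
    both ends being the same linear form in v - w up to o(|v - w|), because
    t(v) -> t(w) and the partial gradients are jointly continuous. *)
Require Import Defs.
From mathcomp Require Import all_boot all_order all_algebra.
From mathcomp Require Import all_classical all_reals all_analysis.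
From mathcomp Require Import ring lra.
Import Order.TTheory GRing.Theory Num.Theory.
Import numFieldNormedType.Exports.

Local Open Scope classical_set_scope.
Local Open Scope ring_scope.

(** * Euclidean inner product, and its comparison with the sup norm *)

Section DotProduct.
Context {R : realType} {k : nat}.
Implicit Types (u v w : 'rV[R]_k) (a : R).

Lemma dotvC u v : dotv u v = dotv v u.
Proof. by apply: eq_bigr => i _; rewrite mulrC. Qed.

Lemma dotvDl u v w : dotv (u + v) w = dotv u w + dotv v w.
Proof. by rewrite -big_split; apply: eq_bigr => i _; rewrite mxE mulrDl. Qed.

Lemma dotvZl a u w : dotv (a *: u) w = a * dotv u w.
Proof. by rewrite big_distrr; apply: eq_bigr => i _; rewrite mxE /= mulrA. Qed.

Lemma dotvNl u w : dotv (- u) w = - dotv u w.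
Proof. by rewrite -scaleN1r dotvZl mulN1r. Qed.

Lemma dotvBl u v w : dotv (u - v) w = dotv u w - dotv v w.
Proof. by rewrite dotvDl dotvNl. Qed.

Lemma dotv0l w : dotv 0 w = 0.
Proof. by rewrite -(scale0r 0) dotvZl mul0r. Qed.

Lemma dotvDr u v w : dotv u (v + w) = dotv u v + dotv u w.
Proof. by rewrite dotvC dotvDl !(dotvC u). Qed.

Lemma dotvZr a u w : dotv u (a *: w) = a * dotv u w.
Proof. by rewrite dotvC dotvZl dotvC. Qed.

Lemma dotvNr u w : dotv u (- w) = - dotv u w.
Proof. by rewrite dotvC dotvNl dotvC. Qed.

Lemma dotvBr u v w : dotv u (v - w) = dotv u v - dotv u w.
Proof. by rewrite dotvDr dotvNr. Qed.

Lemma dotv_suml (I : Type) (r : seq I) (F : I -> 'rV[R]_k) w :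
  dotv (\sum_(i <- r) F i) w = \sum_(i <- r) dotv (F i) w.
Proof.
by elim/big_rec2: _ => [|i y u _ <-]; rewrite ?dotv0l// dotvDl.
Qed.

Lemma dotv_ge0 u : 0 <= dotv u u.
Proof. by apply: sumr_ge0 => i _; rewrite -expr2 sqr_ge0. Qed.

Lemma enorm_sqr u : enorm u ^+ 2 = dotv u u.
Proof. by rewrite sqr_sqrtr// dotv_ge0. Qed.

Lemma normr_coord_le u i : `|u 0 i| <= `|u|.
Proof.
by rewrite [leRHS]/Num.norm /= mx_normrE; apply: (le_bigmax _ _ (0, i)).
Qed.

Lemma normr_rowP u : 0 < `|u| -> exists i, `|u| = `|u 0 i|.
Proof.
move=> u0; have [|[j i] /= ui] := @mx_norm_neq0 _ _ _ u.
  by rewrite gt_eqF.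
by exists i; rewrite (ord1 j) in ui.
Qed.

(** The sup norm is attained at some coordinate, whose square is one term of the sum. *)
Lemma sqr_normr_le_dotv u : `|u| ^+ 2 <= dotv u u.
Proof.
have [u0|] := ltP 0 `|u|; last first.
  by rewrite normr_le0 => /eqP->; rewrite normr0 expr0n/= dotv_ge0.
have [i ->] := normr_rowP _ u0.
rewrite real_normK ?num_real// /dotv (bigD1 i)//= -expr2 lerDl.
by apply: sumr_ge0 => j _; rewrite -expr2 sqr_ge0.
Qed.

Lemma normr_dotv_le u v : `|dotv u v| <= (\sum_i `|u 0 i|) * `|v|.
Proof.
rewrite mulr_suml (le_trans (ler_norm_sum _ _ _))// ler_sum// => i _.
by rewrite normrM ler_wpM2l// normr_coord_le.
Qed.

(** Divide [|v|^2 <= dotv v v <= dotv u v <= |u|_1 |v|] by [|v|]. Coercivity in [theta] and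
    stability of its minimizer both reduce to this bound. *)
Lemma dotv_le_normr u v : dotv v v <= dotv u v -> `|v| <= \sum_i `|u 0 i|.
Proof.
move=> vuv; have [v0|] := ltP 0 `|v|; last first.
  by move=> /le_trans; apply; exact: sumr_ge0.
rewrite -(ler_pM2r v0) -expr2 (le_trans (sqr_normr_le_dotv v))//.
by rewrite (le_trans vuv)// (le_trans (ler_norm _))// normr_dotv_le.
Qed.

Lemma dotv_eq0 u : dotv u u <= 0 -> u = 0.
Proof.
move=> u0; have := @dotv_le_normr 0 u; rewrite dotv0l => /(_ u0).
rewrite big1 ?normr_le0; first by move=> /eqP.
by move=> i _; rewrite mxE normr0.
Qed.

End DotProduct.

(** * Limits of vector-valued maps along a filter *)

Section Convergence.
Context {R : realType} {T : Type} {F : set_system T} {FF : Filter F}.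

Lemma cvg_row k (c : T -> 'rV[R]_k) (l : 'rV[R]_k) :
  (forall i, (fun t => c t 0 i) @ F --> l 0 i) -> c @ F --> l.
Proof.
move=> cl; apply/cvg_ballP => e e0.
have : \forall t \near F, forall i, ball (l 0 i) e (c t 0 i).
  by apply: filter_forall => i; move/cvg_ballP : (cl i) => /(_ _ e0).
by apply: filterS => t bt; split => // j i; rewrite (ord1 j).
Qed.

Lemma cvg_coord k (c : T -> 'rV[R]_k) (l : 'rV[R]_k) i :
  c @ F --> l -> (fun t => c t 0 i) @ F --> l 0 i.
Proof. by move=> cl; exact: (cvg_comp _ _ cl (@coord_continuous _ _ _ 0 i l)). Qed.

Lemma cvg_pairn (U V : topologicalType) (c : T -> U) (c' : T -> V) (x : U) (y : V) :
  c @ F --> x -> c' @ F --> y -> (fun t => (c t, c' t)) @ F --> (x, y).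
Proof. by move=> cx cy; exact: (@cvg_pair _ _ _ F (nbhs x) (nbhs y)). Qed.

Lemma cvg_sumr (I : Type) (r : seq I) (V : normedModType R)
    (c : I -> T -> V) (l : I -> V) :
  (forall i, c i @ F --> l i) ->
  (fun t => \sum_(i <- r) c i t) @ F --> \sum_(i <- r) l i.
Proof.
move=> cl; elim: r => [|i r ih].
  by under eq_fun do rewrite big_nil; rewrite big_nil; exact: cvg_cst.
rewrite big_cons; under eq_fun do rewrite big_cons.
exact: cvgD (cl i) ih.
Qed.

Lemma cvg_dotv k (c c' : T -> 'rV[R]_k) (l l' : 'rV[R]_k) :
  c @ F --> l -> c' @ F --> l' -> (fun t => dotv (c t) (c' t)) @ F --> dotv l l'.
Proof.
by move=> cl cl'; apply: cvg_sumr => i; apply: cvgM; exact: cvg_coord.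
Qed.

(** The l1 distance is the one that [normr_dotv_le] pairs with the sup norm. *)
Lemma cvg_sum_normrB k (c : T -> 'rV[R]_k) (c0 : 'rV[R]_k) (e : R) : 0 < e ->
  c @ F --> c0 -> \forall v \near F, \sum_i `|(c v - c0) 0 i| <= e.
Proof.
move=> e0 cc.
have : (fun v => \sum_i `|(c v - c0) 0 i|) @ F --> \sum_i `|(c0 - c0) 0 i|.
  apply: cvg_sumr => i; apply: cvg_norm; apply: cvg_coord.
  by apply: cvgB => //; exact: cvg_cst.
rewrite (_ : \sum_i `|(c0 - c0) 0 i| = 0); last first.
  by rewrite big1// => i _; rewrite subrr mxE normr0.
by move=> /cvgr_norm_lt /(_ e); rewrite normr0 => /(_ e0); apply: filterS => v;
  move=> /ltW; apply: le_trans; exact: ler_norm.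
Qed.

End Convergence.

(** * Derivatives along lines, and partial gradients *)

Section Derivatives.
Context {R : realType}.

Lemma is_diff_line (V : normedModType R) (a h : V) (s : R) :
  is_diff s (fun t : R => a + t *: h) (fun t : R => t *: h).
Proof.
have := @is_diffD _ _ _ (cst a) (fun t : R => t *: h) 0 (fun t : R => t *: h) s.
by rewrite add0r; apply.
Qed.

Lemma is_derive_curve (V : normedModType R) (f : V -> R) (c dc : R -> V) (s : R) :
  is_diff s c dc -> differentiable f (c s) ->
  is_derive s 1 (fun t : R => f (c t)) ('d f (c s) (dc 1)).
Proof.
move=> dcs df; have df' : is_diff (c s) f ('d f (c s)) by exact: DiffDef.
have dfc := @is_diff_comp _ _ _ _ c _ f _ s dcs df'.
have dd : differentiable (f \o c) s by [].
apply: DeriveDef; first exact/diff_derivable.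
by rewrite deriveE// diff_val /=.
Qed.

(** The bound is one-sided because a feasible segment may leave the set for negative [s]. Divided by
    [s], the slack [s ^+ 2 * K] still vanishes at 0, so it can absorb a quadratic penalty. *)
Lemma derive0_ge (f : R -> R) (c d K : R) :
  is_derive (0 : R) 1 f d ->
  (forall s, 0 < s <= 1 -> s * c - s ^+ 2 * K <= f s - f 0) -> c <= d.
Proof.
move=> [fd <-] fc; rewrite leNgt; apply/negP => dc.
pose e := (c - 'D_1 f 0) / 2.
have e0 : 0 < e by rewrite divr_gt0// subr_gt0.
move: fd => /cvgrPdist_lt /(_ _ e0) /nbhs_normP[/= r r0 rP].
have K0 : 0 < `|K| + 1 by rewrite ltr_wpDl.
(* The three bounds put the difference quotient within [e] of the derivative, make [fc] applicable,
   and give [s * K <= e]. Then [c - e] is at most the quotient, which is below the derivative plus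
   [e]; this contradicts the choice of [e] as half the gap. *)
pose s := Num.min (Num.min (r / 2) 1) (e / (`|K| + 1)).
have s0 : 0 < s by rewrite !lt_min ltr01 andbT; apply/andP; split; apply: divr_gt0.
have sK : s * K <= e.
  rewrite (le_trans (ler_norm _))// normrM gtr0_norm//.
  apply: (@le_trans _ _ (s * (`|K| + 1))); first by rewrite ler_wpM2l ?lerDl// ltW.
  by rewrite -ler_pdivlMr// ge_min lexx orbT.
have := rP s; rewrite /ball_ /= sub0r normrN gtr0_norm//.
rewrite addr0 [s *: 1]mulr1 [_ *: _]/(_ * _).
have sr : s < r by rewrite !gt_min ltr_pdivrMr// ltr_pMr// ltr1n.
move=> /(_ sr (lt0r_neq0 s0)); rewrite ltNge => /negP; apply.
rewrite -[X in _ <= X]normrN opprB (le_trans _ (ler_norm _))// lerBrDr.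
have /fc : 0 < s <= 1 by rewrite s0 !ge_min lexx orbT.
have -> : s * c - s ^+ 2 * K = s * (c - s * K) by ring.
rewrite -ler_pdivlMl// => fs.
have sKe : c - e <= c - s * K by rewrite lerD2l lerN2.
by rewrite (le_trans _ (le_trans sKe fs))// -/(derive f 0 1) lerBrDr -lerBrDl /e; lra.
Qed.

Lemma scalar_dotv k (phi : 'rV[R]_k -> R) :
  (forall a u v, phi (a *: u + v) = a * phi u + phi v) ->
  forall u, phi u = dotv (\row_i phi (delta_mx 0 i)) u.
Proof.
move=> phiP u; have phi0 : phi 0 = 0.
  by have := phiP (-1) 0 0; rewrite scaler0 addr0 mulN1r addNr.
rewrite {1}(row_sum_delta u) /dotv; elim/big_rec2: _ => [|i a b _ <-].
  by rewrite phi0.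
by rewrite phiP mxE mulrC.
Qed.

(** Split the increment into [(h, 0)] and [(0, k)]. On each block the differential is a linear form,
    and its coefficients are partial derivatives because the other variable stays fixed along the
    basis directions. *)
Lemma diff_gradE n m (f : 'rV[R]_n -> 'rV[R]_m -> R) w (h : 'rV[R]_n * 'rV[R]_m) :
  differentiable (fun v => f v.1 v.2) w ->
  'd (fun v => f v.1 v.2) w h =
  dotv (gradx f w.1 w.2) h.1 + dotv (grady f w.1 w.2) h.2.
Proof.
case: w h => x y [h k]; set F := (fun v => f v.1 v.2) => dF /=.
have -> : (h, k) = (h, 0) + (0, k) :> _ * _.
  by congr pair; rewrite /= ?addr0 ?add0r.
rewrite linearD; congr (_ + _).
- rewrite (@scalar_dotv _ (fun u => 'd F (x, y) (u, 0))); last first.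
    move=> a u v; rewrite -linearP; congr ('d F (x, y) _).
    by congr pair; rewrite /= scaler0 addr0.
  congr dotv; apply/rowP => i; rewrite !mxE -deriveE//.
  rewrite /derive; apply: (congr1 (fun g : R -> R => lim (g @ 0^'))); apply/funext => t /=.
  by rewrite /F /= scaler0 add0r.
- rewrite (@scalar_dotv _ (fun u => 'd F (x, y) (0, u))); last first.
    move=> a u v; rewrite -linearP; congr ('d F (x, y) _).
    by congr pair; rewrite /= scaler0 addr0.
  congr dotv; apply/rowP => i; rewrite !mxE -deriveE//.
  rewrite /derive; apply: (congr1 (fun g : R -> R => lim (g @ 0^'))); apply/funext => t /=.
  by rewrite /F /= scaler0 add0r.
Qed.

Lemma is_derive_partialx n m (f : 'rV[R]_n -> 'rV[R]_m -> R)
    (x h : 'rV[R]_n) (y : 'rV[R]_m) (s : R) :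
  differentiable (fun a : 'rV[R]_n * 'rV[R]_m => f a.1 a.2) (x + s *: h, y) ->
  is_derive s 1 (fun t : R => f (x + t *: h) y) (dotv (gradx f (x + s *: h) y) h).
Proof.
move=> df.
have dc := @is_diff_pair _ _ _ _ _ _ _ _ s
  (is_diff_line _ x h s) (is_diff_cst (y : 'rV[R]_m) s).
have := is_derive_curve _ _ _ _ _ dc df.
by rewrite (diff_gradE _ _ f)//= scale1r (dotvC _ 0) dotv0l addr0.
Qed.

Lemma is_derive_partialy n m (f : 'rV[R]_n -> 'rV[R]_m -> R)
    (x : 'rV[R]_n) (y h : 'rV[R]_m) (s : R) :
  differentiable (fun a : 'rV[R]_n * 'rV[R]_m => f a.1 a.2) (x, y + s *: h) ->
  is_derive s 1 (fun t : R => f x (y + t *: h)) (dotv (grady f x (y + s *: h)) h).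
Proof.
move=> df.
have dc := @is_diff_pair _ _ _ _ _ _ _ _ s
  (is_diff_cst (x : 'rV[R]_n) s) (is_diff_line _ y h s).
have := is_derive_curve _ _ _ _ _ dc df.
by rewrite (diff_gradE _ _ f)//= scale1r (dotvC _ 0) dotv0l add0r.
Qed.

End Derivatives.

(** * First-order expansions along a filter *)

Lemma differentiable_near {R : realType} (V : normedModType R) (f : V -> R)
    (a : V) (e : R) :
  differentiable f a -> 0 < e ->
  \forall b \near a, `|f b - f a - 'd f a (b - a)| <= e * `|b - a|.
Proof.
move=> /diff_locallyP[_ /eqaddoP fo] e0.
have /nbhs_normP[r/= r0 rP] := fo _ e0.
apply/nbhs_normP; exists r => // b /=; rewrite /ball_ distrC => br.
have := rP (b - a); rewrite /ball_ /= sub0r normrN => /(_ br).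
rewrite -[X in `|X| <= _ -> _]/(f (b - a + a) - (f a + 'd f a (b - a))) subrK.
by rewrite opprD addrA.
Qed.

Section FirstOrderExpansion.
Context {R : realType} {n m p : nat}.
Let E := ('rV[R]_n * 'rV[R]_m * 'rV[R]_p)%type.
Implicit Types (d h v w : E) (delta : E -> R).

Lemma dot3Dl d d' h : dot3 (d + d') h = dot3 d h + dot3 d' h.
Proof. rewrite /dot3 /= !dotvDl; ring. Qed.

Lemma dot3Zl (a : R) d h : dot3 (a *: d) h = a * dot3 d h.
Proof. rewrite /dot3 /= !dotvZl; ring. Qed.

Lemma normr_triple_le h :
  [/\ `|h.1.1| <= `|h|, `|h.1.2| <= `|h|, `|h.2| <= `|h| & `|h.1| <= `|h|].
Proof.
have h1 : `|h.1| <= `|h| by rewrite [leRHS]prod_normE le_max lexx.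
split=> //; last by rewrite [leRHS]prod_normE le_max lexx orbT.
- by apply: le_trans h1; rewrite [leRHS]prod_normE le_max lexx.
- by apply: le_trans h1; rewrite [leRHS]prod_normE le_max lexx orbT.
Qed.

Lemma normr_dot3_le d : exists2 C : R, 0 <= C & forall h, `|dot3 d h| <= C * `|h|.
Proof.
exists (\sum_i `|d.1.1 0 i| + \sum_i `|d.1.2 0 i| + \sum_i `|d.2 0 i|).
  by rewrite !addr_ge0// sumr_ge0.
move=> h; have [h1 h2 h3 _] := normr_triple_le h.
rewrite !mulrDl (le_trans (ler_normD _ _))// lerD//.
  rewrite (le_trans (ler_normD _ _))// lerD//.
  - by rewrite (le_trans (normr_dotv_le _ _))// ler_wpM2l// sumr_ge0.
  - by rewrite (le_trans (normr_dotv_le _ _))// ler_wpM2l// sumr_ge0.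
by rewrite (le_trans (normr_dotv_le _ _))// ler_wpM2l// sumr_ge0.
Qed.

(** The increment [delta] is arbitrary rather than a difference of values of one function, so that
    it may involve optimizers varying with [v]. *)
Definition expansion (F : set_system E) w delta d :=
  forall e : R, 0 < e ->
    \forall v \near F, `|delta v - dot3 d (v - w)| <= e * `|v - w|.

Context {F : set_system E} {FF : Filter F} {w : E}.

Lemma expansion_eq delta delta' d d' :
  expansion F w delta d -> delta =1 delta' -> d = d' -> expansion F w delta' d'.
Proof. by move=> ed /funext <- <-. Qed.

Lemma expansionD delta delta' d d' :
  expansion F w delta d -> expansion F w delta' d' ->
  expansion F w (fun v => delta v + delta' v) (d + d').
Proof.
move=> ed ed' e e0; have e20 : 0 < e / 2 by rewrite divr_gt0.
apply: filterS2 (ed _ e20) (ed' _ e20) => v dv dv'.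
rewrite dot3Dl opprD addrACA (le_trans (ler_normD _ _))//.
by rewrite (le_trans (lerD dv dv'))// -mulrDl -splitr.
Qed.

(** Since [delta] is already of order [|v - w|], replacing [c v] by its limit costs only
    [o(|v - w|)]. *)
Lemma expansionM (c : E -> R) (c0 : R) delta d :
  c @ F --> c0 -> expansion F w delta d ->
  expansion F w (fun v => c v * delta v) (c0 *: d).
Proof.
move=> cc ed e e0; have [C C0 dC] := normr_dot3_le d.
pose K := `|c0| + 1; have K0 : 0 < K by rewrite ltr_wpDl.
(* [K] eventually bounds [|c v|] and [C] bounds the linear form [dot3 d]; each of the two error
   terms gets half of [e], and the added 1 keeps the denominators positive. *)
have eK : 0 < e / 2 / K by rewrite !divr_gt0.
have C1 : 0 < C + 1 by rewrite ltr_wpDl.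
have eC : 0 < e / 2 / (C + 1) by rewrite !divr_gt0.
have cK : \forall v \near F, `|c v| < K.
  by apply: (cvgr_norm_lt _ cc); rewrite /K ltrDl.
have cC : \forall v \near F, `|c v - c0| < e / 2 / (C + 1).
  exact: cvgr_distC_lt.
apply: filterS3 cK cC (ed _ eK) => v vK vC dv.
have -> : c v * delta v - dot3 (c0 *: d) (v - w) =
    c v * (delta v - dot3 d (v - w)) + (c v - c0) * dot3 d (v - w).
  by rewrite dot3Zl; ring.
rewrite (le_trans (ler_normD _ _))// !normrM [e in leRHS]splitr mulrDl lerD//.
  rewrite (le_trans (ler_pM _ _ (ltW vK) dv))//.
  by rewrite mulrA mulrCA divff ?mulr1// lt0r_neq0.
rewrite (le_trans (ler_pM _ _ (ltW vC) (dC _)))// mulrA ler_wpM2r//.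
by rewrite mulrAC ler_pdivrMr// ler_wpM2l ?lerDl// divr_ge0// ltW.
Qed.

Lemma expansionN delta d :
  expansion F w delta d -> expansion F w (fun v => - delta v) (- d).
Proof.
move=> /(expansionM (cst (-1)) (-1)); rewrite scaleN1r.
by under eq_fun do rewrite mulN1r; apply; exact: cvg_cst.
Qed.

Lemma expansion_sum (I : Type) (r : seq I) (delta : I -> E -> R) (d : I -> E) :
  (forall i, expansion F w (delta i) (d i)) ->
  expansion F w (fun v => \sum_(i <- r) delta i v) (\sum_(i <- r) d i).
Proof.
move=> ed; elim: r => [|i r ih].
  move=> e e0; apply: nearW => v; rewrite !big_nil /dot3/= !dotv0l.
  by rewrite !addr0 subr0 normr0 mulr_ge0// ltW.
rewrite big_cons; under eq_fun do rewrite big_cons.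
exact: expansionD.
Qed.

Lemma expansion_dot2 (c : E -> 'rV[R]_m) (c0 : 'rV[R]_m) : c @ F --> c0 ->
  expansion F w (fun v => dotv (c v) (v.1.2 - w.1.2)) (0, c0, 0).
Proof.
move=> cc e e0; apply: filterS (cvg_sum_normrB _ _ _ _ e0 cc) => v cv.
rewrite /dot3/= !dotv0l add0r addr0 -dotvBl (le_trans (normr_dotv_le _ _))//.
have [_ h _ _] := normr_triple_le (v - w).
by rewrite ler_pM// sumr_ge0.
Qed.

Lemma expansion_dot3 (c : E -> 'rV[R]_p) (c0 : 'rV[R]_p) : c @ F --> c0 ->
  expansion F w (fun v => dotv (c v) (v.2 - w.2)) (0, 0, c0).
Proof.
move=> cc e e0; apply: filterS (cvg_sum_normrB _ _ _ _ e0 cc) => v cv.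
rewrite /dot3/= !dotv0l !add0r -dotvBl (le_trans (normr_dotv_le _ _))//.
have [_ _ h _] := normr_triple_le (v - w).
by rewrite ler_pM// sumr_ge0.
Qed.

Hypothesis Fw : F --> w.

Lemma expansion_diff (f : 'rV[R]_n -> 'rV[R]_m -> R) :
  differentiable (fun a : 'rV[R]_n * 'rV[R]_m => f a.1 a.2) w.1 ->
  expansion F w (fun v => f v.1.1 v.1.2 - f w.1.1 w.1.2)
    (gradx f w.1.1 w.1.2, grady f w.1.1 w.1.2, 0).
Proof.
move=> df e e0; set f2 := (fun _ => _) in df.
have := differentiable_near _ _ _ _ df e0.
move=> /nbhs_normP[r/= r0 rP].
have : \forall v \near F, `|v - w| < r.
  exact: (@cvgr_distC_lt _ _ _ _ _ _ _ Fw).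
apply: filterS => v vr; have [_ _ _ h] := normr_triple_le (v - w).
have := rP v.1; rewrite /ball_ /= distrC => /(_ (le_lt_trans h vr)).
rewrite diff_gradE// /f2/= => fe.
apply: (le_trans _ (le_trans fe _)); last by rewrite ler_wpM2l// ltW.
by rewrite /dot3/= dotv0l addr0.
Qed.

(** The second argument moves with [v], so differentiability at one point is not enough. The mean
    value theorem in [x], with [th v] held fixed, gives [gradx] at a point close to [(w.1.1, th0)],
    where joint continuity applies. *)
Lemma expansion_partial (O : set ('rV[R]_n * 'rV[R]_m)) f th th0 :
  open O -> C1_on O f -> O (w.1.1, th0) -> th @ F --> th0 ->
  expansion F w (fun v => f v.1.1 (th v) - f w.1.1 (th v))
    (gradx f w.1.1 th0, 0, 0).
Proof.
move=> oO fO Ow tht e e0; set x := w.1.1; set G := gradx f x th0.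
have [_ Gc _] := fO _ Ow.
have : \forall a \near (x, th0), O a /\ \sum_i `|(gradx f a.1 a.2 - G) 0 i| <= e.
  by apply: filterI; [exact: open_nbhs_nbhs|exact: cvg_sum_normrB e0 Gc].
move=> /nbhs_normP[r/= r0 rP].
have near_x : \forall v \near F, `|v - w| < r.
  exact: (@cvgr_distC_lt _ _ _ _ _ _ _ Fw).
have near_th : \forall v \near F, `|th0 - th v| < r by exact: cvgr_dist_lt.
apply: filterS2 near_x near_th => v vr thr.
have [hx _ _ _] := normr_triple_le (v - w).
set h := (v - w).1.1 in hx.
(* The product norm is a maximum, so the ball of radius [r] is a product of balls and contains the
   whole segment in the first variable. *)
have seg (s : R) : s \in `[0, 1] -> O (x + s *: h, th v) /\
    \sum_i `|(gradx f (x + s *: h) (th v) - G) 0 i| <= e.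
  rewrite in_itv /= => /andP[s0 s1]; apply: (rP (_, _)).
  rewrite /ball_ /= [X in X < _]prod_normE /= gt_max thr andbT.
  rewrite opprD addrA subrr sub0r normrN normrZ ger0_norm//.
  by rewrite (le_lt_trans _ vr)// (le_trans _ hx)// ler_piMl.
pose phi (s : R) := f (x + s *: h) (th v).
have dphi (s : R) : s \in `[0, 1] ->
    is_derive s 1 phi (dotv (gradx f (x + s *: h) (th v)) h).
  move=> /seg[Os _]; have [df _ _] := fO _ Os.
  exact: is_derive_partialx.
have oo_cc : {subset `]0 : R, 1[ <= `[0, 1]} by exact: subset_itv_oo_cc.
have dphi_oo (s : R) : s \in `]0, 1[ ->
  is_derive s 1 phi (dotv (gradx f (x + s *: h) (th v)) h) by move=> /oo_cc/dphi.
have cphi : {within `[0, 1], continuous phi}.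
  by apply: derivable_within_continuous => s /dphi [].
have [s sI] := MVT_segment ler01 dphi_oo cphi.
rewrite /phi scale1r scale0r addr0 subr0 mulr1 /h /= (addrC x) subrK => ->.
rewrite -/h /dot3/= !dotv0l !addr0 -dotvBl (le_trans (normr_dotv_le _ _))//.
by have [_ Gs] := seg _ sI; rewrite ler_pM// sumr_ge0.
Qed.

End FirstOrderExpansion.
(** Closes the envelope argument: [gv] and [gw] are the gap values at [v] and [w], [lv] is the
    objective at [v] with the optimizers of [w], and [uw] the objective at [w] with those of [v]. *)
Lemma normr_sandwich {R : realDomainType} (lv gv gw uw d r : R) :
  lv <= gv -> uw <= gw -> `|lv - gw - d| <= r -> `|gv - uw - d| <= r ->
  `|gv - gw - d| <= r.
Proof.
move=> lg ug; rewrite !ler_norml => /andP[lo _] /andP[_ up].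
by apply/andP; split; lra.
Qed.

Lemma normr_max0B {R : realDomainType} (a b : R) :
  `|Num.max 0 a - Num.max 0 b| <= `|a - b|.
Proof.
have ab := ler_norm (a - b); have := ler_norm (b - a).
rewrite distrC ler_norml => ba; apply/andP.
by case: (leP 0 a) => a0; case: (leP 0 b) => b0; split; lra.
Qed.

(** * Minimizers with quadratic growth, and projection onto the orthant *)

Section StrongOptimizers.
Context {R : realType} {k : nat}.
Implicit Types (A : set 'rV[R]_k) (F : 'rV[R]_k -> R) (a b u : 'rV[R]_k).

(** Growth at [a] gives minimality at once; for a second minimizer [b] it forces
    [c * dotv (b - a) (b - a) <= 0]. *)
Lemma is_argmin_unique A F (c : R) a : 0 < c -> A a ->
  (forall b, A b -> F a + c * dotv (b - a) (b - a) <= F b) ->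
  unique (is_argmin A F) a.
Proof.
move=> c0 Aa growth; split.
  split=> // b Ab; apply: le_trans (growth _ Ab).
  by rewrite lerDl mulr_ge0 ?dotv_ge0// ltW.
move=> b [Ab bmin]; apply/esym/eqP; rewrite -subr_eq0; apply/eqP/dotv_eq0.
have := le_trans (growth _ Ab) (bmin _ Aa).
by rewrite gerDl pmulr_rle0.
Qed.

Lemma unique_get (T : pointedType) (P : set T) (a : T) : unique P a -> get P = a.
Proof. by move=> [Pa Pu]; apply: get_unique => // b /Pu. Qed.

Definition pos_part u : 'rV[R]_k := \row_i Num.max 0 (u 0 i).

Lemma pos_part_orthant u : orthant R k (pos_part u).
Proof. by move=> i; rewrite mxE le_max lexx. Qed.

(** Per coordinate, the cross term [(b - max 0 u) * (max 0 u - u)] is nonnegative: it is 0 when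
    [0 <= u] and [- (b * u)] otherwise. *)
Lemma pos_part_growth u b : orthant R k b ->
  dotv (pos_part u - u) (pos_part u - u) + dotv (b - pos_part u) (b - pos_part u)
    <= dotv (b - u) (b - u).
Proof.
move=> b0; rewrite /dotv -big_split ler_sum// => i _; rewrite !mxE /=.
by have := b0 i; case: (leP 0 (u 0 i)) => ui bi; nra.
Qed.

Lemma Proj_orthant u : Proj (orthant R k) u = pos_part u.
Proof.
rewrite /Proj /argmin.
have -> : is_argmin (orthant R k) (fun b => enorm (b - u)) =
    is_argmin (orthant R k) (fun b => dotv (b - u) (b - u)).
  apply/seteqP; split => b [b0 bmin]; split=> // a /bmin.
    by rewrite ler_sqrt ?dotv_ge0.
  by move=> ab; rewrite ler_sqrt ?dotv_ge0.
apply/unique_get/(is_argmin_unique _ _ 1) => //; first exact: pos_part_orthant.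
by move=> b b0; rewrite mul1r pos_part_growth.
Qed.

End StrongOptimizers.

(** * The maximizer in [lambda] *)

Section Lambda.
Context {R : realType} {n m p : nat}.
Context (f : 'rV[R]_n -> 'rV[R]_m -> R) (g : 'rV[R]_n -> 'rV[R]_m -> 'rV[R]_p).
Context (gamma2 : R).
Hypothesis gamma2_gt0 : 0 < gamma2.

Lemma lambda_objE x y z lambda :
  lambda_obj f g gamma2 x y z lambda =
  f x y + dotv z (g x y) + gamma2 / 2 * dotv (g x y) (g x y)
  - (2 * gamma2)^-1 * dotv (lambda - (z + gamma2 *: g x y))
                           (lambda - (z + gamma2 *: g x y)).
Proof.
rewrite /lambda_obj enorm_sqr.
have -> : lambda - (z + gamma2 *: g x y) = lambda - z - gamma2 *: g x y.
  by rewrite opprD addrA.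
have [d ->] : exists d, lambda = d + z by exists (lambda - z); rewrite subrK.
rewrite addrK.
rewrite dotvBl !dotvBr !dotvZl !dotvZr dotvDl (dotvC (g x y) d).
by field; rewrite lt0r_neq0.
Qed.

(** By [lambda_objE] the opposite of the objective is, up to a constant, a positive multiple of the
    squared distance to [z + gamma2 *: g x y], so the growth of that distance transfers. *)
Lemma is_argmax_lambda x y z :
  unique (is_argmax (orthant R p) (lambda_obj f g gamma2 x y z))
    (pos_part (z + gamma2 *: g x y)).
Proof.
have -> : is_argmax (orthant R p) (lambda_obj f g gamma2 x y z) =
    is_argmin (orthant R p) (fun l => - lambda_obj f g gamma2 x y z l).
  by apply/seteqP; split => l [l0 lmax]; split=> // s /lmax; rewrite lerN2.
apply: (is_argmin_unique _ _ (2 * gamma2)^-1).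
- by rewrite invr_gt0 mulr_gt0.
- exact: pos_part_orthant.
- move=> b b0; rewrite !lambda_objE !opprB addrAC lerD2r -mulrDr.
  apply: ler_wpM2l; last exact: pos_part_growth.
  by rewrite invr_ge0 mulr_ge0 ?ltW.
Qed.

Lemma lambda_starE x y z :
  lambda_star f g gamma2 x y z = pos_part (z + gamma2 *: g x y).
Proof. exact/unique_get/is_argmax_lambda. Qed.

End Lambda.

(** * The minimizer in [theta]: existence, uniqueness, stability *)

Lemma convex_segment {R : realType} {k : nat} (A : set 'rV[R]_k) (a b : 'rV[R]_k)
    (s : R) :
  convex_set (M := 'rV[R]_k) A -> A a -> A b -> 0 <= s <= 1 ->
  A (a + s *: (b - a)).
Proof.
move=> cA Aa Ab /andP[s0 s1].
have : s *: b + (1 - s) *: a \in A.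
  by apply: (cA b a (Itv01 s0 s1)); rewrite inE.
by rewrite inE scalerBl scale1r scalerBr addrCA.
Qed.

Lemma convex_function_segment {R : realType} {k : nat} (A : set 'rV[R]_k)
    (h : 'rV[R]_k -> R) (a b : 'rV[R]_k) (s : R) :
  convex_function (E := 'rV[R]_k) A h -> A a -> A b -> 0 <= s <= 1 ->
  h (a + s *: (b - a)) <= h a + s * (h b - h a).
Proof.
move=> ch Aa Ab /andP[s0 s1].
have hs : h (s *: b + (1 - s) *: a) <= s * h b + (1 - s) * h a.
  by apply: (ch (Itv01 s0 s1) b a); rewrite inE.
have -> : a + s *: (b - a) = s *: b + (1 - s) *: a.
  by rewrite scalerBl scale1r scalerBr addrCA.
by rewrite (le_trans hs)// le_eqVlt; apply/orP; left; apply/eqP; ring.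
Qed.

(** The arithmetic behind [argmin_theta_dist]: the first two hypotheses are tangent inequalities and
    yield [b <= b'], the last two are variational inequalities, and [q' - q + r] is the squared
    distance of the two minimizers. *)
Lemma strong_monotone_le {R : realDomainType} (i l l' b b' b0 q' q r : R) :
  b <= l' - l -> - b' <= l - l' -> 0 <= b0 + i * q -> 0 <= - (b' + i * q') ->
  i * (q' - q + r) <= b0 - b + i * r.
Proof. by rewrite mulrDr mulrBr; lra. Qed.

Section Theta.
Context {R : realType} {n m p : nat}.
Context (X : set 'rV[R]_n) (Y : set 'rV[R]_m) (O : set ('rV[R]_n * 'rV[R]_m)).
Context (f : 'rV[R]_n -> 'rV[R]_m -> R) (g : 'rV[R]_n -> 'rV[R]_m -> 'rV[R]_p).
Context (gamma1 : R).
Hypotheses (clY : closed Y) (cY : convex_set (M := 'rV[R]_m) Y).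
Hypothesis gamma1_gt0 : 0 < gamma1.
Hypothesis cf : forall x, X x -> convex_function (E := 'rV[R]_m) Y (f x).
Hypothesis cg : forall x, X x -> forall i : 'I_p,
  convex_function (E := 'rV[R]_m) Y (gcomp g i x).
Hypothesis XYO : X `*` Y `<=` O.
Hypotheses (fO : C1_on O f) (gO : forall i : 'I_p, C1_on O (gcomp g i)).

Definition grady_Lagr x y z := grady f x y + wgrady_g g z x y.

Lemma is_derive_Lagr x y z (h : 'rV[R]_m) (s : R) : O (x, y + s *: h) ->
  is_derive s 1 (fun t : R => Lagr f g x (y + t *: h) z)
    (dotv (grady_Lagr x (y + s *: h) z) h).
Proof.
move=> Oxy; have [df _ _] := fO _ Oxy.
have Df := is_derive_partialy _ _ f _ _ _ _ df.
have Dg i : is_derive s 1 (z 0 i \*: (fun t : R => gcomp g i x (y + t *: h)))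
    (z 0 i *: dotv (grady (gcomp g i) x (y + s *: h)) h).
  have [dg _ _] := gO i _ Oxy.
  have := is_derive_partialy _ _ (gcomp g i) _ _ _ _ dg; exact: is_deriveZ.
have := @is_deriveD _ _ _ _ _ _ _ _ _ Df (@is_derive_sum _ _ _ _ _ _ _ _ Dg).
rewrite fct_sumE /grady_Lagr dotvDl dotv_suml.
by under [X in _ -> is_derive _ _ _ (_ + X)]eq_bigr do rewrite dotvZl.
Qed.

Lemma Lagr_convex x z a b (s : R) : X x -> orthant R p z -> Y a -> Y b ->
  0 <= s <= 1 ->
  Lagr f g x (a + s *: (b - a)) z
    <= Lagr f g x a z + s * (Lagr f g x b z - Lagr f g x a z).
Proof.
move=> Xx z0 Ya Yb s01.
have fs := convex_function_segment _ _ _ _ _ (cf _ Xx) Ya Yb s01.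
suff gs : dotv z (g x (a + s *: (b - a))) <=
    dotv z (g x a) + s * (dotv z (g x b) - dotv z (g x a)).
  by rewrite /Lagr; have := lerD fs gs; lra.
rewrite -dotvBr -dotvZr -dotvDr ler_sum// => i _; rewrite ler_wpM2l// !mxE.
exact: convex_function_segment (cg _ Xx i) Ya Yb s01.
Qed.

(** Convexity bounds the increments along the segment by the chord. As [derive0_ge] bounds
    derivatives from below, it is applied to the opposite function, with zero slack. *)
Lemma Lagr_tangent x z a b : X x -> orthant R p z -> Y a -> Y b ->
  dotv (grady_Lagr x a z) (b - a) <= Lagr f g x b z - Lagr f g x a z.
Proof.
move=> Xx z0 Ya Yb; rewrite -lerN2.
have Oxa : O (x, a + 0 *: (b - a)) by rewrite scale0r addr0; exact: XYO.
have := is_derive_Lagr _ _ z _ _ Oxa; rewrite scale0r addr0 => D.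
have ND : is_derive (0 : R) 1 (fun t : R => - Lagr f g x (a + t *: (b - a)) z)
    (- dotv (grady_Lagr x a z) (b - a)) by exact: is_deriveN D.
apply: (derive0_ge _ _ _ 0 ND) => s /andP[s0 s1].
have s01 : 0 <= s <= 1 by rewrite ltW.
have := Lagr_convex _ _ _ _ _ Xx z0 Ya Yb s01.
by rewrite scale0r addr0; lra.
Qed.

Let c := (2 * gamma1)^-1.
Let c_gt0 : 0 < c. Proof. by rewrite invr_gt0 mulr_gt0. Qed.

Lemma theta_objE x y z theta :
  theta_obj f g gamma1 x y z theta = Lagr f g x theta z + c * dotv (theta - y) (theta - y).
Proof. by rewrite /theta_obj enorm_sqr. Qed.

Lemma dotv_sqrD (a b y : 'rV[R]_m) :
  dotv (b - y) (b - y) =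
  dotv (a - y) (a - y) + 2 * dotv (a - y) (b - a) + dotv (b - a) (b - a).
Proof.
have -> : b - y = (a - y) + (b - a) by rewrite [RHS]addrC subrKA.
move: (a - y) (b - a) => u v.
rewrite dotvDl !dotvDr (dotvC v u); ring.
Qed.

(** First-order optimality: a step from [a] towards [b] stays in [Y], hence cannot lower the
    objective. *)
Lemma theta_variational x y z a b : X x -> orthant R p z -> Y b ->
  is_argmin Y (theta_obj f g gamma1 x y z) a ->
  0 <= dotv (grady_Lagr x a z + gamma1^-1 *: (a - y)) (b - a).
Proof.
move=> Xx z0 Yb [Ya amin]; set d := b - a.
have Oxa : O (x, a + 0 *: d) by rewrite scale0r addr0; exact: XYO.
have := is_derive_Lagr _ _ z _ _ Oxa; rewrite scale0r addr0 => D.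
suff : - (2 * c * dotv (a - y) d) <= dotv (grady_Lagr x a z) d.
  rewrite (dotvDl (grady_Lagr _ _ _)) dotvZl /c invfM mulrA divff ?pnatr_eq0// mul1r; lra.
(* Only the Lagrangian is differentiated; the penalty is expanded exactly, and its term of order
   [s ^+ 2] is the slack. *)
apply: (derive0_ge _ _ _ (c * dotv d d) D) => s /andP[s0 s1].
have s01 : 0 <= s <= 1 by rewrite ltW.
have := amin _ (convex_segment _ _ _ _ cY Ya Yb s01); rewrite -/d.
rewrite !theta_objE (dotv_sqrD a (a + _) y) [a + _ - a]addrAC subrr add0r.
rewrite !dotvZr !dotvZl scale0r addr0 expr2.
set L := Lagr _ _ _ _ _; set L' := Lagr _ _ _ _ _.
by move: L L' => L L'; nra.
Qed.

(** The tangent inequality plus the exact expansion of the square at [a] leave the growth term and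
    the pairing that [theta_variational] makes nonnegative. *)
Lemma theta_growth x y z a b : X x -> orthant R p z -> Y b ->
  is_argmin Y (theta_obj f g gamma1 x y z) a ->
  theta_obj f g gamma1 x y z a + c * dotv (b - a) (b - a)
    <= theta_obj f g gamma1 x y z b.
Proof.
move=> Xx z0 Yb amin; have [Ya _] := amin.
have := theta_variational _ _ _ _ _ Xx z0 Yb amin.
have := Lagr_tangent _ _ _ _ Xx z0 Ya Yb.
rewrite !theta_objE (dotv_sqrD a b y) (dotvDl (grady_Lagr _ _ _)) dotvZl.
have -> : gamma1^-1 = 2 * c by rewrite /c invfM mulrA divff ?pnatr_eq0// mul1r.
by lra.
Qed.

Lemma is_argmin_theta_unique x y z a : X x -> orthant R p z ->
  is_argmin Y (theta_obj f g gamma1 x y z) a ->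
  unique (is_argmin Y (theta_obj f g gamma1 x y z)) a.
Proof.
move=> Xx z0 amin; apply: (is_argmin_unique _ _ _ _ c_gt0); first by case: amin.
by move=> b Yb; exact: theta_growth.
Qed.

Lemma cvg_Lagr {T : Type} {F : set_system T} {FF : Filter F}
    (cx : T -> 'rV[R]_n) (cy : T -> 'rV[R]_m) (cz : T -> 'rV[R]_p) x y z :
  O (x, y) -> cx @ F --> x -> cy @ F --> y -> cz @ F --> z ->
  (fun t => Lagr f g (cx t) (cy t) (cz t)) @ F --> Lagr f g x y z.
Proof.
move=> Oxy cxx cyy czz; apply: cvgD.
  have [df _ _] := fO _ Oxy.
  exact: (continuous2_cvg _ (differentiable_continuous df) cxx cyy).
apply: cvg_dotv => //; apply: cvg_row => i; have [dg _ _] := gO i _ Oxy.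
exact: (continuous2_cvg _ (differentiable_continuous dg) cxx cyy).
Qed.

Lemma cvg_theta_obj {T : Type} {F : set_system T} {FF : Filter F}
    (ct : T -> 'rV[R]_m) x y z theta :
  O (x, theta) -> ct @ F --> theta ->
  (fun t => theta_obj f g gamma1 x y z (ct t)) @ F -->
    theta_obj f g gamma1 x y z theta.
Proof.
move=> Oxt ctt; rewrite theta_objE; under eq_fun do rewrite theta_objE.
apply: cvgD; first by apply: cvg_Lagr => //; exact: cvg_cst.
apply: cvgM; first exact: cvg_cst.
by apply: cvg_dotv; apply: cvgB => //; exact: cvg_cst.
Qed.

Lemma exists_theta x y z : X x -> Y y -> orthant R p z ->
  exists a, is_argmin Y (theta_obj f g gamma1 x y z) a.
Proof.
move=> Xx Yy z0; set F := theta_obj f g gamma1 x y z.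
(* If [F theta <= F y], the tangent inequality at [y] gives [c |theta - y|^2 <= - dotv (grady_Lagr x
   y z) (theta - y)] in Euclidean norm, hence [dotv (theta - y) (theta - y) <= dotv G (theta -
   y)]. *)
pose G := - c^-1 *: grady_Lagr x y z.
pose M := \sum_i `|G 0 i|.
have coercive theta : Y theta -> F theta <= F y -> `|y - theta| <= M.
  move=> Yt Ft; rewrite distrC; apply: dotv_le_normr.
  have := Lagr_tangent _ _ _ _ Xx z0 Yy Yt.
  move: Ft; rewrite /F !theta_objE subrr dotv0l mulr0 addr0 => Ft tan.
  rewrite dotvZl mulNr -mulrN ler_pdivlMl//; lra.
pose K := Y `&` closed_ball_ Num.norm y M.
have M0 : 0 <= M by exact: sumr_ge0.
have Ky : K y by split=> //; rewrite /closed_ball_ /= subrr normr0.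
have cK : compact K.
  apply: bounded_closed_compact; last first.
    by apply: closedI => //; exact: closed_closed_ball_.
  exists (`|y| + M); split; first exact: num_real.
  move=> r rM theta [_ /= yt]; rewrite (le_trans _ (ltW rM))//.
  by rewrite -lerBlDl (le_trans (lerB_dist _ _))// distrC.
have Fc : {within K, continuous F}.
  apply: continuous_in_subspaceT => theta /[!inE] -[Yt _].
  have Oxt : O (x, theta) by exact: XYO.
  exact: (@cvg_theta_obj _ (nbhs theta) (nbhs_filter theta) id x y z theta Oxt cvg_id).
have [a /[!inE] -[Ya _] amin] := EVT_min_rV (ex_intro _ y Ky) cK Fc.
have amin' theta : K theta -> F a <= F theta by move=> Kt; apply: amin; rewrite inE.
(* A point with value at least [F y] cannot beat [a], since [y] lies in [K]; any other point of [Y]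
   lies in [K] by coercivity. *)
exists a; split=> // theta Yt; have [|/ltW Ft] := leP (F y) (F theta).
  by apply: le_trans; exact: amin'.
by apply: amin'; split=> //; exact: coercive.
Qed.

Lemma theta_starP x y z : X x -> Y y -> orthant R p z ->
  is_argmin Y (theta_obj f g gamma1 x y z) (theta_star Y f g gamma1 x y z).
Proof. by move=> Xx Yy z0; apply: getPex; exact: exists_theta. Qed.

(* Adding the variational inequalities at the two minimizers and using that
   [grady_Lagr x' ^~ z'] is monotone, only gradients at the fixed point [a]
   remain. *)
Lemma argmin_theta_dist x y z a x' y' z' a' :
  X x -> orthant R p z -> X x' -> orthant R p z' ->
  is_argmin Y (theta_obj f g gamma1 x y z) a ->
  is_argmin Y (theta_obj f g gamma1 x' y' z') a' ->
  `|a' - a|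
    <= \sum_i `|(gamma1 *: (grady_Lagr x a z - grady_Lagr x' a z') + (y' - y)) 0 i|.
Proof.
move=> Xx z0 Xx' z0' amin amin'.
have [Ya _] := amin; have [Ya' _] := amin'.
have va := theta_variational _ _ _ _ _ Xx z0 Ya' amin.
have va' := theta_variational _ _ _ _ _ Xx' z0' Ya amin'.
have ta := Lagr_tangent _ _ _ _ Xx' z0' Ya Ya'.
have ta' := Lagr_tangent _ _ _ _ Xx' z0' Ya' Ya.
apply: dotv_le_normr; set d := a' - a.
rewrite -(opprB a' a) -/d in va' ta'; rewrite -/d in va ta.
rewrite dotvNr in va'; rewrite dotvNr in ta'.
rewrite -(ler_pM2l (_ : 0 < gamma1^-1)) ?invr_gt0//.
rewrite (dotvDl (_ *: _)) dotvZl mulrDr mulKf ?lt0r_neq0//.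
have dE : dotv d d = dotv (a' - y') d - dotv (a - y) d + dotv (y' - y) d.
  by rewrite -dotvBl -dotvDl; congr dotv; apply/rowP => i; rewrite !mxE; ring.
rewrite dE (dotvBl (grady_Lagr _ _ _)).
rewrite !(dotvDl (grady_Lagr _ _ _)) !dotvZl in va va'.
exact: (strong_monotone_le _ _ _ _ _ _ _ _ _ ta ta' va va').
Qed.

(** * The gap function as an attained maximum *)

Context (gamma2 : R).
Hypothesis gamma2_gt0 : 0 < gamma2.

Let E := ('rV[R]_n * 'rV[R]_m * 'rV[R]_p)%type.
Let S : set E := X `*` Y `*` orthant R p.

(** [gap_grad] with the optimizers as free arguments, so that frozen and moving optimizers share one
    limit formula. *)
Definition gap_grad_at x y z theta lambda : E :=
  (gradx f x y + wgradx_g g lambda x y,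
   grady f x y + wgrady_g g lambda x y,
   - (gamma2^-1 *: (z - lambda)))
  - (gradx f x theta + wgradx_g g z x theta, gamma1^-1 *: (y - theta), g x theta).

Lemma gap_objE x y z theta lambda :
  gap_obj f g gamma1 gamma2 x y z (theta, lambda) =
  lambda_obj f g gamma2 x y z lambda - theta_obj f g gamma1 x y z theta.
Proof. by rewrite /gap_obj /lambda_obj /theta_obj /Lagr /=; ring. Qed.

Lemma is_argmax_gap_obj x y z theta lambda :
  is_argmin Y (theta_obj f g gamma1 x y z) theta ->
  is_argmax (orthant R p) (lambda_obj f g gamma2 x y z) lambda ->
  is_argmax (Y `*` orthant R p) (gap_obj f g gamma1 gamma2 x y z) (theta, lambda).
Proof.
move=> [Yt tmin] [l0 lmax]; split=> // -[t l] [/= Yt' l0'].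
by rewrite !gap_objE lerB// ?tmin// lmax.
Qed.

(** A maximizer makes the set of values nonempty and bounded above, which excludes the default value
    of [sup]. *)
Lemma gapE x y z tl :
  is_argmax (Y `*` orthant R p) (gap_obj f g gamma1 gamma2 x y z) tl ->
  gap Y f g gamma1 gamma2 x y z = gap_obj f g gamma1 gamma2 x y z tl.
Proof.
move=> [Ytl tlmax]; apply/eqP; rewrite eq_le; apply/andP; split.
  apply: ge_sup => [|_ [s Ss <-]]; last exact: tlmax.
  by exists (gap_obj f g gamma1 gamma2 x y z tl); exists tl.
by apply: ub_le_sup; [eexists => _ [s Ss <-]; exact: tlmax|exists tl].
Qed.

(** * Limits and expansions at [w] along a filter carried by [S] *)

Section Along.
Context {F : set_system E} {FF : Filter F} {w : E}.
Hypotheses (Fw : F --> w) (FS : \forall v \near F, S v) (Sw : S w).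

Let x0 := w.1.1.
Let y0 := w.1.2.
Let z0 := w.2.

Let cx : (fun v : E => v.1.1) @ F --> x0.
Proof. exact: (cvg_comp _ _ (cvg_comp _ _ Fw cvg_fst) cvg_fst). Qed.

Let cy : (fun v : E => v.1.2) @ F --> y0.
Proof. exact: (cvg_comp _ _ (cvg_comp _ _ Fw cvg_fst) cvg_snd). Qed.

Let cz : (fun v : E => v.2) @ F --> z0.
Proof. exact: (cvg_comp _ _ Fw cvg_snd). Qed.

Let Oxy : O (x0, y0).
Proof. by case: Sw => -[Xx Yy] _; exact: XYO. Qed.

Lemma cvg_g th theta : O (x0, theta) -> th @ F --> theta ->
  (fun v : E => g v.1.1 (th v)) @ F --> g x0 theta.
Proof.
move=> Oxt tht; apply: cvg_row => i; have [dg _ _] := gO i _ Oxt.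
exact: (continuous2_cvg _ (differentiable_continuous dg) cx tht).
Qed.

Lemma cvg_gradx f0 th theta : C1_on O f0 -> O (x0, theta) -> th @ F --> theta ->
  (fun v : E => gradx f0 v.1.1 (th v)) @ F --> gradx f0 x0 theta.
Proof. by move=> f0O /f0O[_ cd _] tht; exact: (continuous2_cvg _ cd cx tht). Qed.

Lemma cvg_grady f0 th theta : C1_on O f0 -> O (x0, theta) -> th @ F --> theta ->
  (fun v : E => grady f0 v.1.1 (th v)) @ F --> grady f0 x0 theta.
Proof. by move=> f0O /f0O[_ _ cd] tht; exact: (continuous2_cvg _ cd cx tht). Qed.

Lemma cvg_wgradx_g la lambda th theta : O (x0, theta) ->
  th @ F --> theta -> la @ F --> lambda ->
  (fun v : E => wgradx_g g (la v) v.1.1 (th v)) @ F --> wgradx_g g lambda x0 theta.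
Proof.
move=> Oxt tht lal; apply: cvg_sumr => i; apply: cvgZ; first exact: (cvg_coord _ _ _ i lal).
exact: (cvg_gradx _ _ _ (gO i) Oxt tht).
Qed.

Lemma cvg_wgrady_g la lambda th theta : O (x0, theta) ->
  th @ F --> theta -> la @ F --> lambda ->
  (fun v : E => wgrady_g g (la v) v.1.1 (th v)) @ F --> wgrady_g g lambda x0 theta.
Proof.
move=> Oxt tht lal; apply: cvg_sumr => i; apply: cvgZ; first exact: (cvg_coord _ _ _ i lal).
exact: (cvg_grady _ _ _ (gO i) Oxt tht).
Qed.

Lemma cvg_theta_star :
  (fun v : E => theta_star Y f g gamma1 v.1.1 v.1.2 v.2) @ F -->
    theta_star Y f g gamma1 x0 y0 z0.
Proof.
have [[Xx Yy] Oz] := Sw.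
have amin := theta_starP _ _ _ Xx Yy Oz; have [Ya _] := amin.
set a := theta_star _ _ _ _ _ _ _ in amin Ya *.
have Oxa : O (x0, a) by exact: XYO.
(* The vector whose l1 norm bounds the displacement of the minimizer. Its gradients are taken at the
   fixed [a], so its limit does not presuppose convergence of [theta_star]. *)
pose A (v : E) := gamma1 *: (grady_Lagr x0 a z0 - grady_Lagr v.1.1 a v.2) + (v.1.2 - y0).
have cA : A @ F --> (0 : 'rV[R]_m).
  have -> : 0 = gamma1 *: (grady_Lagr x0 a z0 - grady_Lagr x0 a z0) + (y0 - y0).
    by rewrite !subrr scaler0 addr0.
  apply: cvgD; last by apply: cvgB => //; exact: cvg_cst.
  apply: cvgZ; first exact: cvg_cst.
  apply: cvgB; first exact: cvg_cst.
  apply: cvgD; first exact: (cvg_grady _ _ _ fO Oxa (cvg_cst a)).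
  exact: (cvg_wgrady_g _ _ _ _ Oxa (cvg_cst a) cz).
apply/cvgrPdist_le => e e0.
apply: filterS2 FS (cvg_sum_normrB _ _ _ _ e0 cA) => v [[Xv Yv] Ov] Av.
have vmin := theta_starP _ _ _ Xv Yv Ov.
rewrite distrC (le_trans (argmin_theta_dist _ _ _ _ _ _ _ _ Xx Oz Xv Ov amin vmin))//.
by move: Av; rewrite subr0.
Qed.

(** Each coordinate of [pos_part] is nonexpansive, and its argument [z + gamma2 *: g x y]
    converges. *)
Lemma cvg_lambda_star :
  (fun v : E => lambda_star f g gamma2 v.1.1 v.1.2 v.2) @ F -->
    lambda_star f g gamma2 x0 y0 z0.
Proof.
rewrite lambda_starE//; under eq_fun do rewrite lambda_starE//.
have cu : (fun v : E => v.2 + gamma2 *: g v.1.1 v.1.2) @ F --> z0 + gamma2 *: g x0 y0.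
  by apply: cvgD => //; apply: cvgZ; [exact: cvg_cst|exact: cvg_g].
apply: cvg_row => i; have := cvg_coord _ _ _ i cu.
move=> /cvgrPdist_le ci; apply/cvgrPdist_le => e e0.
apply: filterS (ci _ e0) => v; apply: le_trans; rewrite !mxE.
exact: normr_max0B.
Qed.

Lemma cvg_gap_grad_at (th : E -> 'rV[R]_m) (la : E -> 'rV[R]_p) theta
    (lambda : 'rV[R]_p) : O (x0, theta) ->
  th @ F --> theta -> la @ F --> lambda ->
  (fun v : E => gap_grad_at v.1.1 v.1.2 v.2 (th v) (la v)) @ F -->
    gap_grad_at x0 y0 z0 theta lambda.
Proof.
move=> Oxt tht lal; apply: cvgB; apply: cvg_pairn; first apply: cvg_pairn.
- by apply: cvgD; [exact: cvg_gradx|exact: cvg_wgradx_g].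
- by apply: cvgD; [exact: cvg_grady|exact: cvg_wgrady_g].
- by apply: cvgN; apply: cvgZ; [exact: cvg_cst|exact: cvgB].
- apply: cvg_pairn.
    by apply: cvgD; [exact: cvg_gradx|exact: cvg_wgradx_g].
  by apply: cvgZ; [exact: cvg_cst|exact: cvgB].
- exact: cvg_g.
Qed.

(** Moving the centre of a quadratic penalty from [b'] to [b] changes it by a difference of squares,
    here factored as a pairing with [b - b'] to suit [expansion_dot2] and [expansion_dot3]. *)
Lemma polarization {k} (a : R) (u b b' : 'rV[R]_k) : 0 < a ->
  dotv (a^-1 *: u - (2 * a)^-1 *: (b + b')) (b - b') =
  - ((2 * a)^-1 * (dotv (u - b) (u - b) - dotv (u - b') (u - b'))).
Proof.
move=> a0; rewrite /dotv -sumrB big_distrr -sumrN.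
by apply: eq_bigr => i _; rewrite !mxE /=; field; rewrite lt0r_neq0.
Qed.

Lemma sum_pair (U V : nmodType) (I : Type) (r : seq I) (a : I -> U) (b : I -> V) :
  \sum_(i <- r) (a i, b i) = (\sum_(i <- r) a i, \sum_(i <- r) b i).
Proof.
by elim: r => [|i r ih]; [rewrite !big_nil|rewrite !big_cons ih].
Qed.

Lemma expansion_weighted_sum (delta : 'I_p -> E -> R) (dx : 'I_p -> 'rV[R]_n)
    (dy : 'I_p -> 'rV[R]_m) (la : E -> 'rV[R]_p) (lambda : 'rV[R]_p) : la @ F --> lambda ->
  (forall i, expansion F w (delta i) (dx i, dy i, 0)) ->
  expansion F w (fun v => \sum_i la v 0 i * delta i v)
    (\sum_i lambda 0 i *: dx i, \sum_i lambda 0 i *: dy i, 0).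
Proof.
move=> lal de.
have -> : (\sum_i lambda 0 i *: dx i, \sum_i lambda 0 i *: dy i, 0) =
    \sum_i lambda 0 i *: (dx i, dy i, 0) :> E.
  rewrite !sum_pair; congr (_, _).
  by rewrite big1// => i _; rewrite /= scaler0.
by apply: expansion_sum => i; apply: expansionM => //; exact: cvg_coord.
Qed.

Lemma expansion_gap_obj (th : E -> 'rV[R]_m) (la : E -> 'rV[R]_p) theta
    (lambda : 'rV[R]_p) : open O -> O (x0, theta) ->
  th @ F --> theta -> la @ F --> lambda ->
  expansion F w (fun v => gap_obj f g gamma1 gamma2 v.1.1 v.1.2 v.2 (th v, la v)
                        - gap_obj f g gamma1 gamma2 x0 y0 z0 (th v, la v))
    (gap_grad_at x0 y0 z0 theta lambda).
Proof.
move=> oO Oxt tht lal.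
have dw f0 : C1_on O f0 -> differentiable (fun a : 'rV[R]_n * 'rV[R]_m => f0 a.1 a.2) w.1.
  by move=> f0O; have [] := f0O w.1; first by case: Sw => -[Xx Yy] _; exact: XYO.
have /(_ FF) efxy := expansion_diff Fw _ (dw _ fO).
have /(_ FF) egxy := expansion_weighted_sum _ _ _ _ _ lal
  (fun i => expansion_diff Fw _ (dw _ (gO i))).
have /(_ FF) eft := expansion_partial Fw _ _ _ _ oO fO Oxt tht.
(* The increment of [dotv z (g x theta)] is split bilinearly: weights [z0] on the increment of [g]
   in [x], then [g] at the new point paired with [v.2 - z0]. *)
have /(_ FF) egt := expansion_weighted_sum _ _ _ _ _ (@cvg_cst _ z0 _ F FF)
  (fun i => expansion_partial Fw _ _ _ _ oO (gO i) Oxt tht).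
have /(_ FF) eg := @expansion_dot3 _ _ _ _ _ _ w _ _ (cvg_g _ _ Oxt tht).
have ez : expansion F w
    (fun v => dotv (gamma2^-1 *: la v - (2 * gamma2)^-1 *: (v.2 + z0)) (v.2 - z0))
    (0, 0, gamma2^-1 *: lambda - (2 * gamma2)^-1 *: (z0 + z0)).
  apply: expansion_dot3; apply: cvgB; apply: cvgZ => //; [exact: cvg_cst..|].
  by apply: cvgD => //; exact: cvg_cst.
have ey : expansion F w
    (fun v => dotv (gamma1^-1 *: th v - (2 * gamma1)^-1 *: (v.1.2 + y0)) (v.1.2 - y0))
    (0, gamma1^-1 *: theta - (2 * gamma1)^-1 *: (y0 + y0), 0).
  apply: expansion_dot2; apply: cvgB; apply: cvgZ => //; [exact: cvg_cst..|].
  by apply: cvgD => //; exact: cvg_cst.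
apply: expansion_eq.
- apply: expansionD.
    exact: (expansionD _ _ _ _ (expansionD _ _ _ _ efxy egxy) ez).
  apply: expansionD ey; apply: expansionN.
  exact: (expansionD _ _ _ _ (expansionD _ _ _ _ eft egt) eg).
- move=> v; rewrite !gap_objE /lambda_obj !theta_objE !enorm_sqr.
  have sumE (u : 'rV[R]_p) x y x' y' :
      \sum_i u 0 i * (gcomp g i x y - gcomp g i x' y') = dotv u (g x y) - dotv u (g x' y').
    by rewrite -dotvBr; apply: eq_bigr => i _; rewrite !mxE.
  rewrite !sumE !polarization// /Lagr (dotvBr (g _ _)) !(dotvC (g _ _)).
  by rewrite -/x0 -/y0 -/z0 /c; ring.
(* In the limit both centres coincide, so [(2 * a)^-1 *: (b + b)] becomes [a^-1 *: b], as in
   [gap_grad_at]. *)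
- have half (a : R) : 0 < a -> a^-1 = 2 * (2 * a)^-1.
    by move=> a0; rewrite invfM mulrA divff ?pnatr_eq0// mul1r.
  have pairP (U V : Type) (a b : U * V) : a.1 = b.1 -> a.2 = b.2 -> a = b.
    by case: a b => [? ?] [? ?] /= -> ->.
  apply/pairP; [apply/pairP|] => /=.
  - by rewrite !addr0.
  - rewrite [\sum_i z0 0 i *: 0]big1 => [|i _]; last by rewrite scaler0.
    rewrite !(addr0, oppr0, add0r); congr (_ + _).
    by rewrite (half _ gamma1_gt0); apply/rowP => i; rewrite !mxE; ring.
  - rewrite !(addr0, add0r); congr (_ + _).
    by rewrite (half _ gamma2_gt0); apply/rowP => i; rewrite !mxE; ring.
Qed.

End Along.
End Theta.

(** The first conjunct certifies that [argmin], [argmax] and [maxval], through which the second is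
    phrased, denote genuine optimizers and an attained maximum. *)
Theorem lemma2p2 (R : realType) (n m p : nat)
    (X : set 'rV[R]_n) (Y : set 'rV[R]_m)
    (f : 'rV[R]_n -> 'rV[R]_m -> R) (g : 'rV[R]_n -> 'rV[R]_m -> 'rV[R]_p)
    (gamma1 gamma2 : R) (O : set ('rV[R]_n * 'rV[R]_m)) :
  closed X -> convex_set (M := 'rV[R]_n) X ->
  closed Y -> convex_set (M := 'rV[R]_m) Y ->
  0 < gamma1 -> 0 < gamma2 ->
  (forall x, X x -> convex_function (E := 'rV[R]_m) Y (f x)) ->
  (forall x, X x -> forall i : 'I_p,
     convex_function (E := 'rV[R]_m) Y (gcomp g i x)) ->
  open O -> X `*` Y `<=` O ->
  C1_on O f -> (forall i : 'I_p, C1_on O (gcomp g i)) ->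
  (forall x y z, X x -> Y y -> orthant R p z ->
     [/\ exists tl, is_argmax (Y `*` orthant R p) (gap_obj f g gamma1 gamma2 x y z) tl,
         exists! theta, is_argmin Y (theta_obj f g gamma1 x y z) theta,
         exists! lambda, is_argmax (orthant R p) (lambda_obj f g gamma2 x y z) lambda &
         lambda_star f g gamma2 x y z = Proj (orthant R p) (z + gamma2 *: g x y)]) /\
  C1_within_with_gradient (X `*` Y `*` orthant R p)
    (fun w => gap Y f g gamma1 gamma2 w.1.1 w.1.2 w.2)
    (fun w => gap_grad Y f g gamma1 gamma2 w.1.1 w.1.2 w.2).
Proof.
move=> clX cX clY cY g1 g2 cf cg oO XYO fO gO.
have thetaP x y z : X x -> Y y -> orthant R p z ->
    is_argmin Y (theta_obj f g gamma1 x y z) (theta_star Y f g gamma1 x y z).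
  exact: (theta_starP X Y O f g gamma1 clY g1 cf cg XYO fO gO).
have lambdaP x y z : is_argmax (orthant R p) (lambda_obj f g gamma2 x y z)
    (lambda_star f g gamma2 x y z).
  by rewrite lambda_starE//; have [] := is_argmax_lambda f g _ g2 x y z.
have gap_max x y z : X x -> Y y -> orthant R p z ->
    is_argmax (Y `*` orthant R p) (gap_obj f g gamma1 gamma2 x y z)
      (theta_star Y f g gamma1 x y z, lambda_star f g gamma2 x y z).
  by move=> Xx Yy Oz; apply: is_argmax_gap_obj; [exact: thetaP|exact: lambdaP].
split.
  move=> x y z Xx Yy Oz; split.
  - by eexists; exact: gap_max.
  - exists (theta_star Y f g gamma1 x y z).
    apply: (is_argmin_theta_unique X Y O) => //; exact: thetaP.
  - by eexists; exact: (is_argmax_lambda f g gamma2 g2).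
  - by rewrite lambda_starE// Proj_orthant.
set S := X `*` Y `*` orthant R p.
pose E := ('rV[R]_n * 'rV[R]_m * 'rV[R]_p)%type.
pose t (w : E) :=
  (theta_star Y f g gamma1 w.1.1 w.1.2 w.2, lambda_star f g gamma2 w.1.1 w.1.2 w.2).
have gapE' (w : E) : S w -> gap Y f g gamma1 gamma2 w.1.1 w.1.2 w.2 =
    gap_obj f g gamma1 gamma2 w.1.1 w.1.2 w.2 (t w).
  by move=> [[Xx Yy] Oz]; apply: gapE; exact: gap_max.
(* The feasible set [Y] times the orthant is the same at every point, so the optimizers of [v]
   compete at [w]. *)
have gap_le (w v : E) : S w -> S v -> gap_obj f g gamma1 gamma2 w.1.1 w.1.2 w.2 (t v) <=
    gap Y f g gamma1 gamma2 w.1.1 w.1.2 w.2.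
  move=> Sw [[Xv Yv] Ov]; rewrite (gapE' _ Sw); case: Sw => -[Xx Yy] Oz.
  have [_] := gap_max _ _ _ Xx Yy Oz; apply; split=> /=.
    by have [] := thetaP _ _ _ Xv Yv Ov.
  by have [] := lambdaP v.1.1 v.1.2 v.2.
have FF (w : E) : Filter (within S (nbhs w)) by exact: (within_filter S (nbhs_filter w)).
have Fw (w : E) : within S (nbhs w) --> w by exact: cvg_within.
have FS (w : E) : \forall v \near within S (nbhs w), S v by exact: near_withinT.
have tht (w : E) : S w -> (fun v => (t v).1) @ within S (nbhs w) --> (t w).1.
  by move=> Sw; exact: (cvg_theta_star X Y O).
have lat (w : E) : S w -> (fun v => (t v).2) @ within S (nbhs w) --> (t w).2.
  by move=> Sw; exact: (cvg_lambda_star X Y O).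
have Ot (w : E) : S w -> O (w.1.1, (t w).1).
  by move=> [[Xx Yy] Oz]; apply: XYO; split=> //=; have [] := thetaP _ _ _ Xx Yy Oz.
split; last first.
  apply/subspace_continuousP => w Sw.
  by apply: (cvg_gap_grad_at X Y O) => //; [exact: Ot|exact: tht|exact: lat].
move=> w Sw e e0.
have eobj := @expansion_gap_obj _ _ _ _ X Y O f g gamma1 g1 XYO fO gO gamma2 g2
  (within S (nbhs w)) (FF w) w (Fw w) Sw.
(* Optimizers frozen at [t w] here, moving with [v] in [upper]: both converge to [t w], hence the
   same linear form. *)
have lower := eobj (cst (t w).1) (cst (t w).2) _ _ oO (Ot _ Sw)
  (@cvg_cst _ _ _ _ (FF w)) (@cvg_cst _ _ _ _ (FF w)).
have upper := eobj (fun v => (t v).1) (fun v => (t v).2) _ _ oO (Ot _ Sw)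
  (tht _ Sw) (lat _ Sw).
have FFw := FF w.
apply: filterS3 (FS w) (lower _ e0) (upper _ e0) => v Sv.
have wv := gap_le _ _ Sw Sv; have vw := gap_le _ _ Sv Sw.
rewrite (gapE' _ Sw) in wv *; rewrite (gapE' _ Sv) in vw *.
exact: normr_sandwich vw wv.
Qed.
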